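(* Let $\Phi$ be the full subcategory of $\mathbf{adc}$ consisting of the non-zero augmented directed complexes with loop-free unital bases. Then the functor \[ V\colon\Delta\wr\Phi\to\Phi \] is fully faithful.
   Context: Augmented directed complexes. An augmented directed complex is an augmented chain complex $K$ of abelian groups concentrated in nonnegative dimensions (boundary $\partial$, augmentation $\epsilon\colon K_0\to\mathbf{Z}$), together with a distinguished submonoid $K_q^*$ of each chain group $K_q$. A morphism $K\to L$ is an augmentation-preserving chain map taking $K_q^*$ into $L_q^*$ for each $q$. The resulting category is $\mathbf{adc}$. $K$ is identified with the direct sum $K_0\oplus K_1\oplus\ldots$. Bases. $K$ has a basis if the chain groups are free abelian with prescribed bases such that each $K_q^*$ is the submonoid generated by the prescribed basis elements of $K_q$; the union of these bases is the (graded) basis of $K$, and $|b|$ denotes the degree of a basis element $b$. (Such a basis is unique if it exists.) For a chain $x$ of positive degree in an augmented directed complex with basis, write $\partial x=\partial^+x-\partial^-x$ where $\partial^+x$ and $\partial^-x$ are sums of basis elements with no common terms. The basis is unital if $\epsilon(\partial^-)^{|b|}b=\epsilon(\partial^+)^{|b|}b=1$ for every basis element $b$. The basis is loop-free if for every $q\geq 0$ there is a (strict) partial ordering $<_q$ on the basis elements of degree at least $q$ such that $a<_q b$ whenever $a$ is a term in $(\partial^-)^{|b|-q}b$ with $|b|>q$, or $b$ is a term in $(\partial^+)^{|a|-q}a$ with $|a|>q$. Wreath products. For a category $\mathcal{A}$, the objects of $\Delta\wr\mathcal{A}$ are the pairs $(m,A)$ with $m$ a nonnegative integer and $A=(A^1,\ldots,A^m)$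 an $m$-tuple of objects of $\mathcal{A}$. The morphisms $(m,A)\to(n,B)$ are the pairs $(\phi,f)$ where $\phi=(\phi(0),\ldots,\phi(m))$ is a tuple of integers with $0\leq\phi(0)\leq\phi(1)\leq\ldots\leq\phi(m)\leq n$, and $f$ is a family of morphisms $f_i^j\colon A^i\to B^j$ in $\mathcal{A}$, one for each pair $(i,j)$ with $1\leq i\leq m$ and $\phi(i-1)<j\leq\phi(i)$. Composition is $(\psi,g)\circ(\phi,f)=(\psi\circ\phi,g\circ f)$, where $(\psi\circ\phi)(i)=\psi(\phi(i))$ and $(g\circ f)_i^k=g_j^k\circ f_i^j$ for $\psi\circ\phi(i-1)\leq\psi(j-1)\leq k-1<k\leq\psi(j)\leq\psi\circ\phi(i)$. The functor $V\colon\Delta\wr\mathbf{adc}\to\mathbf{adc}$. For an object $(m,K)$ with $K=(K^1,\ldots,K^m)$, let $\mathbf{Z}p^i$ ($0\leq i\leq m$) be a free abelian group on one generator $p^i$, and let $s\colon K^i\to sK^i$ ($1\leq i\leq m$) be an isomorphism of abelian groups onto a copy of $K^i$. Then $V(m,K)=\mathbf{Z}p^0\oplus sK^1\oplus\mathbf{Z}p^1\oplus\ldots\oplus\mathbf{Z}p^{m-1}\oplus sK^m\oplus\mathbf{Z}p^m$, with degrees $|p^i|=0$, $|sx|=|x|+1$; boundary $\partial sx=s\partial x$ if $x\in K^i$ with $|x|>0$, $\partial sx=(\epsilon x)(p^i-p^{i-1})$ if $x\in K^i$ with $|x|=0$, and $\partial p^i=0$; augmentation $\epsilon p^i=1$;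 and distinguished submonoid generated by the $p^i$ and the images under $s$ of the distinguished submonoids of the $K^i$. For a morphism $(\phi,f)\colon(m,K)\to(n,L)$, $V(\phi,f)$ is the homomorphism with $p^i\mapsto p^{\phi(i)}$ for $0\leq i\leq m$ and $sx\mapsto\sum_{\phi(i-1)<j\leq\phi(i)}sf_i^jx$ for $x\in K^i$. This functor maps $\Delta\wr\Phi$ into $\Phi$, and the functor $V\colon\Delta\wr\Phi\to\Phi$ is the resulting restriction. *)

(* Defs.v *)
From HB Require Import structures.
From mathcomp Require Import all_boot all_order all_algebra.
From mathcomp Require Import boolp classical_sets.

Set Implicit Arguments.
Unset Strict Implicit.
Unset Printing Implicit Defensive.

Import Order.TTheory GRing.Theory Num.Theory.
Local Open Scope ring_scope.

#[local] Obligation Tactic := idtac.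

Record category := Category {
  Ob :> Type;
  Hom : Ob -> Ob -> Type;
  idm : forall X, Hom X X;
  mcomp : forall X Y Z, Hom Y Z -> Hom X Y -> Hom X Z;
  comp1m : forall X Y (f : Hom X Y), mcomp (idm Y) f = f;
  compm1 : forall X Y (f : Hom X Y), mcomp f (idm X) = f;
  compA : forall X Y Z W (h : Hom Z W) (g : Hom Y Z) (f : Hom X Y),
    mcomp h (mcomp g f) = mcomp (mcomp h g) f }.

Arguments Hom {c} _ _.
Arguments idm {c} X.
Arguments mcomp {c X Y Z} _ _.

Record functor (C D : category) := Functor {
  fob :> C -> D;
  fhom : forall X Y : C, Hom X Y -> Hom (fob X) (fob Y);
  fhom1 : forall X, fhom (idm X) = idm (fob X);
  fhomM : forall X Y Z (g : Hom Y Z) (f : Hom X Y),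
    fhom (mcomp g f) = mcomp (fhom g) (fhom f) }.

Arguments fhom {C D} _ {X Y} _.

Definition fully_faithful (C D : category) (F : functor C D) : Prop :=
  forall X Y : C, bijective (@fhom C D F X Y).

Definition full_sub (C : category) (P : C -> Prop) : category :=
  @Category {X : C | P X} (fun X Y => Hom (sval X) (sval Y))
    (fun X => idm (sval X)) (fun X Y Z g f => mcomp g f)
    (fun X Y => @comp1m C (sval X) (sval Y))
    (fun X Y => @compm1 C (sval X) (sval Y))
    (fun X Y Z W => @compA C (sval X) (sval Y) (sval Z) (sval W)).

Definition full_incl (C : category) (P : C -> Prop) : functor (full_sub P) C :=
  @Functor (full_sub P) C (fun X => sval X) (fun X Y f => f)
    (fun X => erefl) (fun X Y Z g f => erefl).

Program Definition functor_comp (C D E : category)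
    (G : functor D E) (F : functor C D) : functor C E :=
  @Functor C E (fun X => G (F X)) (fun X Y f => fhom G (fhom F f)) _ _.
Next Obligation. by move=> * /=; rewrite !fhom1. Qed.
Next Obligation. by move=> * /=; rewrite !fhomM. Qed.

Definition functor_lift (C D : category) (P : D -> Prop) (F : functor C D)
    (PF : forall X, P (F X)) : functor C (full_sub P) :=
  @Functor C (full_sub P) (fun X => exist P (F X) (PF X))
    (fun X Y f => fhom F f) (fun X => fhom1 F X)
    (fun X Y Z g f => fhomM F g f).

(* Components are numbered from 0: the components [A^1, ..., A^m] are indexed
   by ['I_m], and [i : 'I_m] stands for the interval from [lo i = i] to
   [hi i = i + 1] in [{0, ..., m}], so the condition
   [phi (i - 1) < j <= phi i] becomes [phi (lo i) <= j < phi (hi i)]. *)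

Definition lo m (i : 'I_m) : 'I_m.+1 := widen_ord (leqnSn m) i.
Definition hi m (i : 'I_m) : 'I_m.+1 := @Ordinal m.+1 i.+1 (ltn_ord i).

Definition in_block m n (phi : 'I_m.+1 -> 'I_n.+1) (i : 'I_m) (j : 'I_n) :=
  (phi (lo i) <= j < phi (hi i))%N.

Lemma in_block_id m (i j : 'I_m) : in_block id i j -> i = j.
Proof. by rewrite /in_block ltnS -eqn_leq => /eqP E; apply: val_inj. Qed.


Section Blocks.
Variables (m n p : nat).
Variables (phi : 'I_m.+1 -> 'I_n.+1) (psi : 'I_n.+1 -> 'I_p.+1).
Hypothesis phi_mono : forall i j : 'I_m.+1, (i <= j)%N -> (phi i <= phi j)%N.
Hypothesis psi_mono : forall i j : 'I_n.+1, (i <= j)%N -> (psi i <= psi j)%N.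

Lemma in_block_comp i j k :
  in_block phi i j -> in_block psi j k -> in_block (psi \o phi) i k.
Proof.
move=> /andP[h1 h2] /andP[h3 h4]; apply/andP; split => /=.
  exact: leq_trans (psi_mono _) h3.
exact: leq_trans h4 (psi_mono _).
Qed.

Lemma in_block_uniq j j' k : in_block psi j k -> in_block psi j' k -> j = j'.
Proof.
suff H (a b : 'I_n) : in_block psi a k -> in_block psi b k -> (b <= a)%N.
  by move=> h h'; apply/val_inj/anti_leq; rewrite !H.
move=> /andP[_ h1] /andP[h2 _]; rewrite leqNgt; apply/negP => ab.
by have /leq_trans/(_ h2) := psi_mono (ab : (hi a <= lo b)%N); rewrite leqNgt h1.
Qed.

Lemma in_block_mid i k : in_block (psi \o phi) i k ->
  exists j : 'I_n, in_block phi i j && in_block psi j k.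
Proof.
rewrite {1}/in_block /=; set a := phi (lo i); set b := phi (hi i).
move=> /andP[ha hb].
suff [j [j1 j2 j3]] : exists j : 'I_n, [/\ (a <= j)%N, (j < b)%N & in_block psi j k].
  by exists j; rewrite j3 /in_block j1 j2.
move: (b) hb => [x xn]; elim: x xn => [|x IH] xn hb.
  suff: (psi (Ordinal xn) <= psi a)%N by rewrite leqNgt (leq_ltn_trans ha hb).
  exact: psi_mono.
have xn' : (x < n.+1)%N by apply: ltnW.
have [hx|hx] := ltnP k (psi (Ordinal xn')).
  by have [j [j1 j2 j3]] := IH xn' hx; exists j; split=> //; apply: ltnW.
have [xa|ax] := ltnP x a.
  suff: (psi (Ordinal xn) <= psi a)%N by rewrite leqNgt (leq_ltn_trans ha hb).
  exact: psi_mono.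
have xn2 : (x < n)%N by [].
exists (Ordinal xn2); split=> //; apply/andP; split.
  by apply: leq_trans hx; apply: psi_mono.
by rewrite (_ : hi _ = Ordinal xn) //; apply: val_inj.
Qed.

End Blocks.

Lemma telescope_block n (W : zmodType) (F : 'I_n.+1 -> W) (a b : 'I_n.+1) :
  (a <= b)%N ->
  \sum_(j < n | (a <= j < b)%N) (F (hi j) - F (lo j)) = F b - F a.
Proof.
case: b => b bn /=; elim: b bn => [|b IH] bn ab.
  rewrite big1 => [|j]; last by rewrite ltn0 andbF.
  have -> : a = Ordinal bn by apply: val_inj; apply/eqP; rewrite -leqn0.
  by rewrite subrr.
have bn' : (b < n.+1)%N by apply: ltnW.
move: ab; rewrite leq_eqVlt => /orP[/eqP ab|ab].
  rewrite big1 => [|j]; first by rewrite (_ : a = Ordinal bn) ?subrr //; apply: val_inj.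
  by rewrite ab => /andP[/leq_ltn_trans h/h]; rewrite ltnn.
have bn2 : (b < n)%N by [].
rewrite (bigD1 (Ordinal bn2)) /=; last by rewrite ltnS in ab; rewrite ab leqnn.
have -> : F (hi (Ordinal bn2)) = F (Ordinal bn) by congr F; apply: val_inj.
have -> : F (lo (Ordinal bn2)) = F (Ordinal bn') by congr F; apply: val_inj.
rewrite -[RHS](subrKA (F (Ordinal bn'))); congr (_ + _).
rewrite -IH //; apply: eq_bigl => j; rewrite ltnS -andbA; congr (_ && _).
by rewrite ltn_neqAle andbC.
Qed.

Section Wreath.
Variable C : category.

Record wr_ob := WrOb { wr_len : nat; wr_comp :> 'I_wr_len -> C }.

Record wr_hom (X Y : wr_ob) := WrHom {
  wr_map : 'I_(wr_len X).+1 -> 'I_(wr_len Y).+1;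
  wr_mono : forall i j : 'I_(wr_len X).+1,
    (i <= j)%N -> (wr_map i <= wr_map j)%N;
  wr_fam : forall i j, in_block wr_map i j -> Hom (X i) (Y j) }.

Arguments wr_fam {X Y} _ {i j} _.

Lemma wr_hom_eq X Y (f g : wr_hom X Y) : wr_map f =1 wr_map g ->
  (forall i j (hf : in_block (wr_map f) i j) (hg : in_block (wr_map g) i j),
    wr_fam f hf = wr_fam g hg) -> f = g.
Proof.
case: f g => [p pm f] [p' pm' g] /= /funext E; subst p'.
rewrite (Prop_irrelevance pm' pm) => Efg; congr WrHom.
apply: functional_extensionality_dep => i.
apply: functional_extensionality_dep => j.
apply: functional_extensionality_dep => h; exact: Efg.
Qed.

Definition wr_id X : wr_hom X X :=
  @WrHom X X id (fun _ _ => id) (fun i j h =>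
    eq_rect i (fun j => Hom (X i) (X j)) (idm (X i)) j (in_block_id h)).


Section Comp.
Variables (X Y Z : wr_ob) (g : wr_hom Y Z) (f : wr_hom X Y).
Variables (i : 'I_(wr_len X)) (k : 'I_(wr_len Z)).
Hypothesis h : in_block (wr_map g \o wr_map f) i k.

Let exj := in_block_mid (@wr_mono _ _ g) h.

(* The unique [j] through which the component [i -> k] of a composite goes,
   see [in_block_uniq]. *)
Definition wr_mid : 'I_(wr_len Y) := xchoose exj.

Lemma wr_midl : in_block (wr_map f) i wr_mid.
Proof. by have /andP[] := xchooseP exj. Qed.

Lemma wr_midr : in_block (wr_map g) wr_mid k.
Proof. by have /andP[] := xchooseP exj. Qed.

End Comp.

Definition wr_compm X Y Z (g : wr_hom Y Z) (f : wr_hom X Y) : wr_hom X Z :=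
  @WrHom X Z (wr_map g \o wr_map f)
    (fun i j ij => wr_mono g (wr_mono f ij))
    (fun i k h => mcomp (wr_fam g (wr_midr h)) (wr_fam f (wr_midl h))).

Lemma wr_compE X Y Z (g : wr_hom Y Z) (f : wr_hom X Y) i j k
    (h1 : in_block (wr_map f) i j) (h2 : in_block (wr_map g) j k)
    (h : in_block (wr_map (wr_compm g f)) i k) :
  wr_fam (wr_compm g f) h = mcomp (wr_fam g h2) (wr_fam f h1).
Proof.
rewrite /=; move: (wr_midr h) (wr_midl h); set j' := wr_mid h => h2' h1'.
have E : j' = j := in_block_uniq (@wr_mono _ _ g) h2' h2.
move: (j') E h1' h2' => _ -> h1' h2'.
by rewrite (bool_irrelevance h1' h1) (bool_irrelevance h2' h2).
Qed.

Lemma wr_idE X i (h : in_block (wr_map (wr_id X)) i i) :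
  wr_fam (wr_id X) h = idm (X i).
Proof. by rewrite /= (Prop_irrelevance (in_block_id h) erefl). Qed.

Lemma wr_comp1m X Y (f : wr_hom X Y) : wr_compm (wr_id Y) f = f.
Proof.
apply: wr_hom_eq => // i j hf hg.
have h : in_block (wr_map (wr_id Y)) j j by rewrite /in_block /= leqnn ltnSn.
by rewrite (wr_compE hg h hf) wr_idE comp1m.
Qed.

Lemma wr_compm1 X Y (f : wr_hom X Y) : wr_compm f (wr_id X) = f.
Proof.
apply: wr_hom_eq => // i j hf hg.
have h : in_block (wr_map (wr_id X)) i i by rewrite /in_block /= leqnn ltnSn.
by rewrite (wr_compE h hg hf) wr_idE compm1.
Qed.

Lemma wr_compA X Y Z W (h : wr_hom Z W) (g : wr_hom Y Z) (f : wr_hom X Y) :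
  wr_compm h (wr_compm g f) = wr_compm (wr_compm h g) f.
Proof.
apply: wr_hom_eq => // i l h1 h2.
have a1 : in_block (wr_map (wr_compm g f)) i _ := wr_midl h1.
have b1 := wr_midr h1; have a2 := wr_midl a1; have b2 := wr_midr a1.
have h3 : in_block (wr_map (wr_compm h g)) _ l :=
  in_block_comp (@wr_mono _ _ h) b2 b1.
by rewrite (wr_compE a1 b1 h1) (wr_compE a2 b2 a1) (wr_compE a2 h3 h2)
  (wr_compE b2 b1 h3) compA.
Qed.

Definition wreath : category :=
  @Category wr_ob wr_hom wr_id wr_compm wr_comp1m wr_compm1 wr_compA.

End Wreath.

Arguments wr_fam {C X Y} _ {i j} _.

Section WreathFunctor.
Variables (C D : category) (F : functor C D).

Definition wrF_ob (X : wreath C) : wreath D := WrOb (fun i => F (X i)).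

Definition wrF_hom (X Y : wreath C) (f : Hom X Y) : Hom (wrF_ob X) (wrF_ob Y) :=
  @WrHom D (wrF_ob X) (wrF_ob Y) (wr_map f) (@wr_mono _ _ _ f)
    (fun i j h => fhom F (wr_fam f h)).

Lemma wrF_hom1 X : wrF_hom (idm X) = idm (wrF_ob X).
Proof.
apply: wr_hom_eq => // i j hf hg; have E := in_block_id hf; subst j.
rewrite [RHS](wr_idE hg) -[LHS]/(fhom F (wr_fam (wr_id X) _)).
by rewrite wr_idE fhom1.
Qed.

Lemma wrF_homM X Y Z (g : Hom Y Z) (f : Hom X Y) :
  wrF_hom (mcomp g f) = mcomp (wrF_hom g) (wrF_hom f).
Proof.
apply: wr_hom_eq => // i k hf hg.
have h1 := @wr_midl _ _ _ _ g f _ _ hf.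
have h2 := @wr_midr _ _ _ _ g f _ _ hf.
rewrite -[LHS]/(fhom F (wr_fam (wr_compm g f) hf)) (wr_compE h1 h2 hf) fhomM.
by rewrite [RHS](@wr_compE _ _ _ _ (wrF_hom g) (wrF_hom f) _ _ _ h1 h2 hg).
Qed.

Definition wreath_functor : functor (wreath C) (wreath D) :=
  Functor wrF_hom1 wrF_homM.

End WreathFunctor.

(* [dst] is the distinguished submonoid [K_q^*] of each chain group [K_q]. *)
Record adc_ob := Adc {
  ch :> nat -> zmodType;
  bd : forall q, {additive ch q.+1 -> ch q};
  aug : {additive ch 0%N -> int};
  bd_bd : forall q (x : ch q.+2), bd q (bd q.+1 x) = 0;
  aug_bd : forall x : ch 1%N, aug (bd 0%N x) = 0;
  dst : forall q, set (ch q);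
  dst0 : forall q, dst (0 : ch q);
  dstD : forall q (x y : ch q), dst x -> dst y -> dst (x + y) }.

Arguments bd {a q}.
Arguments aug {a}.
Arguments dst {a q}.

Record adc_hom (K L : adc_ob) := AdcHom {
  hmap :> forall q, {additive K q -> L q};
  hmap_bd : forall q (x : K q.+1), bd (hmap q.+1 x) = hmap q (bd x);
  hmap_aug : forall x : K 0%N, aug (hmap 0%N x) = aug x;
  hmap_dst : forall q (x : K q), dst x -> dst (hmap q x) }.

Lemma additive_eq (U V : zmodType) (f g : {additive U -> V}) : f =1 g -> f = g.
Proof.
case: f g => [f [[cf]]] [g [[cg]]] /= /funext E; subst g.
by rewrite (Prop_irrelevance cg cf).
Qed.

Lemma adc_hom_eq K L (f g : adc_hom K L) : (forall q, f q =1 g q) -> f = g.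
Proof.
case: f g => [f f1 f2 f3] [g g1 g2 g3] /= E.
have {}E : f = g.
  by apply: functional_extensionality_dep => q; apply: additive_eq; exact: E.
subst g; rewrite (Prop_irrelevance g1 f1) (Prop_irrelevance g2 f2).
by rewrite (Prop_irrelevance g3 f3).
Qed.

Definition adc_id K : adc_hom K K :=
  @AdcHom K K (fun q => idfun) (fun _ _ => erefl) (fun _ => erefl)
    (fun _ _ => id).

Program Definition adc_comp K L M (g : adc_hom L M) (f : adc_hom K L) :
    adc_hom K M :=
  @AdcHom K M (fun q => g q \o f q) _ _ _.
Next Obligation. by move=> K L M g f q x /=; rewrite !hmap_bd. Qed.
Next Obligation. by move=> K L M g f x /=; rewrite !hmap_aug. Qed.
Next Obligation. by move=> K L M g f q x ? /=; do 2![apply: hmap_dst]. Qed.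

Program Definition adc : category :=
  @Category adc_ob adc_hom adc_id adc_comp _ _ _.
Next Obligation. by move=> *; apply: adc_hom_eq. Qed.
Next Obligation. by move=> *; apply: adc_hom_eq. Qed.
Next Obligation. by move=> *; apply: adc_hom_eq. Qed.

Section GroupBases.
Variable V : zmodType.
Implicit Types (B : set V) (x : V) (s : seq V).

Definition all_in B s : Prop := forall b, b \in s -> B b.

Definition gen_submonoid B : set V :=
  fun x => exists2 s, all_in B s & x = \sum_(b <- s) b.

Lemma gen_submonoid0 B : gen_submonoid B 0.
Proof. by exists [::]; rewrite ?big_nil. Qed.

Lemma gen_submonoidD B x y :
  gen_submonoid B x -> gen_submonoid B y -> gen_submonoid B (x + y).
Proof.
move=> [s hs ->] [t ht ->]; exists (s ++ t); last by rewrite big_cat.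
by move=> b; rewrite mem_cat => /orP[/hs|/ht].
Qed.

Lemma gen_submonoid_incl B x : B x -> gen_submonoid B x.
Proof.
by move=> Bx; exists [:: x]; rewrite ?big_seq1 // => b /[!inE] /eqP ->.
Qed.

Lemma gen_submonoid_sum B (I : eqType) (r : seq I) (F : I -> V) :
  (forall i, i \in r -> gen_submonoid B (F i)) ->
  gen_submonoid B (\sum_(i <- r) F i).
Proof.
move=> h; rewrite big_seq; elim/big_ind: _ => //; first exact: gen_submonoid0.
by move=> *; apply: gen_submonoidD.
Qed.

Definition zbasis B : Prop :=
  (forall x, exists s (c : V -> int),
     all_in B s /\ x = \sum_(b <- s) b *~ c b) /\
  (forall s (c : V -> int), uniq s -> all_in B s ->
     \sum_(b <- s) b *~ c b = 0 -> forall b, b \in s -> c b = 0).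

(* [p = (y, z)] with [x = y - z], where [y] and [z] are sums of basis elements
   with no common terms; for a basis [B] there is exactly one such [p]. *)
Definition is_parts B x (p : V * V) : Prop :=
  exists s t, [/\ all_in B s, all_in B t, forall b, b \in s -> b \notin t,
    p = (\sum_(b <- s) b, \sum_(b <- t) b) & x = p.1 - p.2].

Definition parts B x : V * V := xget (0, 0) (is_parts B x).

Definition is_term B b x : Prop :=
  exists s, [/\ all_in B s, b \in s & x = \sum_(a <- s) a].

End GroupBases.

(* Homogeneous chains: elements of [K_0 ⊕ K_1 ⊕ ...] together with a degree *)
Definition hchain (K : adc_ob) := {q : nat & K q}.
Definition hch (K : adc_ob) q (x : K q) : hchain K := existT _ q x.
Definition deg (K : adc_ob) (x : hchain K) : nat := projT1 x.

Definition haug (K : adc_ob) (x : hchain K) : int :=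
  match x with existT 0 y => aug y | _ => 0 end.

Section Bases.
Variables (K : adc_ob) (B : forall q, set (K q)).

Definition is_basis : Prop :=
  forall q, zbasis (@B q) /\ @dst K q = gen_submonoid (@B q).

(* [bdpart true] is [∂^+] and [bdpart false] is [∂^-]; the value in degree 0,
   where these are not defined, plays no role below. *)
Definition bdpart (e : bool) (x : hchain K) : hchain K :=
  match x with
  | existT 0 y => hch (0 : K 0%N)
  | existT q.+1 y =>
      let p := parts (@B q) (bd y) in hch (if e then p.1 else p.2)
  end.

Definition basis_elt (b : hchain K) : Prop := B (projT2 b).

Definition is_hterm (a x : hchain K) : Prop :=
  exists q (a' x' : K q), [/\ a = hch a', x = hch x' & is_term (@B q) a' x'].

Definition unital : Prop :=
  forall b, basis_elt b ->
    haug (iter (deg b) (bdpart false) b) = 1 /\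
    haug (iter (deg b) (bdpart true) b) = 1.

Definition basis_ge q (b : hchain K) : Prop := basis_elt b /\ (q <= deg b)%N.

Definition loop_free : Prop :=
  forall q, exists lt : hchain K -> hchain K -> Prop,
    [/\ forall a, basis_ge q a -> ~ lt a a,
        forall a b c, basis_ge q a -> basis_ge q b -> basis_ge q c ->
          lt a b -> lt b c -> lt a c,
        forall a b, basis_ge q a -> basis_ge q b -> (q < deg b)%N ->
          is_hterm a (iter (deg b - q) (bdpart false) b) -> lt a b
      & forall a b, basis_ge q a -> basis_ge q b -> (q < deg a)%N ->
          is_hterm b (iter (deg a - q) (bdpart true) a) -> lt a b].

End Bases.

Definition in_Phi (K : adc) : Prop :=
  (exists q (x : K q), x <> 0) /\
  exists B : forall q, set (K q), [/\ is_basis B, unital B & loop_free B].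

Definition Phi : category := full_sub in_Phi.

Section DirectSum.
Variables (I : finType) (T : I -> zmodType).

Definition dsum := {dffun forall i, T i}.
HB.instance Definition _ := Choice.on dsum.

Implicit Types u v w : dsum.

Definition dsum_add u v : dsum := [ffun i => u i + v i].
Definition dsum_opp u : dsum := [ffun i => - u i].
Definition dsum_zero : dsum := [ffun=> 0].

Lemma dsum_addA : associative dsum_add.
Proof. by move=> u v w; apply/ffunP => i; rewrite !ffunE addrA. Qed.
Lemma dsum_addC : commutative dsum_add.
Proof. by move=> u v; apply/ffunP => i; rewrite !ffunE addrC. Qed.
Lemma dsum_add0 : left_id dsum_zero dsum_add.
Proof. by move=> u; apply/ffunP => i; rewrite !ffunE add0r. Qed.
Lemma dsum_addN : left_inverse dsum_zero dsum_opp dsum_add.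
Proof. by move=> u; apply/ffunP => i; rewrite !ffunE addNr. Qed.

HB.instance Definition _ :=
  GRing.isZmodule.Build dsum dsum_addA dsum_addC dsum_add0 dsum_addN.

Definition dcomp i u : T i := u i.
Lemma dcomp_additive i : zmod_morphism (dcomp i).
Proof. by move=> u v; rewrite /dcomp !ffunE. Qed.
HB.instance Definition _ i :=
  GRing.isZmodMorphism.Build dsum (T i) (dcomp i) (dcomp_additive i).

Definition din i (x : T i) : dsum := [ffun j => @dfwith I T (fun k => 0) i x j].

Lemma dcomp_in i x : dcomp i (din x) = x.
Proof. by rewrite /dcomp ffunE dfwith_in. Qed.

Lemma dcomp_out i j x : i != j -> dcomp j (@din i x) = 0.
Proof. by move=> ij; rewrite /dcomp ffunE dfwith_out. Qed.

Lemma dsumP u v : (forall i, dcomp i u = dcomp i v) -> u = v.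
Proof. by move=> E; apply/ffunP. Qed.

Lemma din_additive i : zmod_morphism (@din i).
Proof.
move=> x y; apply: dsumP => j; rewrite raddfB /=.
by have [<-|ij] := eqVneq i j; [rewrite !dcomp_in|rewrite !dcomp_out ?subr0].
Qed.
HB.instance Definition _ i :=
  GRing.isZmodMorphism.Build (T i) dsum (@din i) (@din_additive i).

Lemma dsum_sum u : u = \sum_i din (dcomp i u).
Proof.
apply: dsumP => j; rewrite raddf_sum (bigD1 j) //= dcomp_in big1 ?addr0 //.
by move=> i ij; rewrite dcomp_out.
Qed.

Lemma dsum_ext (W : zmodType) (f g : {additive dsum -> W}) :
  (forall i (x : T i), f (din x) = g (din x)) -> f =1 g.
Proof.
by move=> E u; rewrite (dsum_sum u) !raddf_sum; apply: eq_bigr.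
Qed.

Lemma din_inj i : injective (@din i).
Proof. by move=> x y /(congr1 (@dcomp i)); rewrite !dcomp_in. Qed.

End DirectSum.

Section VObj.
Variable X : wreath adc.
Local Notation m := (wr_len X).

(* [V(m, K)] has [Z p^0 ⊕ ... ⊕ Z p^m] in degree 0 and [sK^1_q ⊕ ... ⊕ sK^m_q]
   in degree [q + 1]; the summand [sX i] lies between [p^(lo i)] and
   [p^(hi i)]. *)
Definition Vch (q : nat) : zmodType :=
  match q with
  | 0 => dsum (fun _ : 'I_m.+1 => int)
  | q'.+1 => dsum (fun i : 'I_m => X i q')
  end.

Definition Vp (i : 'I_m.+1) : Vch 0 := 
  @din _ (fun _ : 'I_m.+1 => int) i 1.

Definition Vs (i : 'I_m) q : X i q -> Vch q.+1 := 
  @din _ (fun i => X i q) i.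

Definition Vbd0 (x : Vch 1) : Vch 0 :=
  \sum_i (Vp (hi i) - Vp (lo i)) *~ aug (dcomp i x).

Definition VbdS q (x : Vch q.+2) : Vch q.+1 := \sum_i Vs (bd (dcomp i x)).

Definition Vaug (u : Vch 0) : int := \sum_i dcomp i u.

Definition Vdst q : set (Vch q) :=
  match q with
  | 0 => gen_submonoid (fun u => exists i, u = Vp i)
  | q'.+1 => gen_submonoid (fun u => exists i (x : X i q'), dst x /\ u = Vs x)
  end.

Lemma Vs_additive i q : zmod_morphism (@Vs i q).
Proof. exact: raddfB. Qed.
HB.instance Definition _ i q :=
  GRing.isZmodMorphism.Build (X i q) (Vch q.+1) (@Vs i q) (@Vs_additive i q).

Lemma Vbd0_additive : zmod_morphism Vbd0.
Proof.
move=> x y; rewrite /Vbd0 -sumrB; apply: eq_bigr => i _.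
by rewrite raddfB /= raddfB mulrzBr.
Qed.
HB.instance Definition _ :=
  GRing.isZmodMorphism.Build (Vch 1) (Vch 0) Vbd0 Vbd0_additive.

Lemma VbdS_additive q : zmod_morphism (@VbdS q).
Proof.
move=> x y; rewrite /VbdS -sumrB; apply: eq_bigr => i _.
by rewrite raddfB /= raddfB /= raddfB.
Qed.
HB.instance Definition _ q :=
  GRing.isZmodMorphism.Build (Vch q.+2) (Vch q.+1) (@VbdS q) (@VbdS_additive q).

Lemma Vaug_additive : zmod_morphism Vaug.
Proof.
by move=> x y; rewrite /Vaug -sumrB; apply: eq_bigr => i _; rewrite raddfB.
Qed.
HB.instance Definition _ :=
  GRing.isZmodMorphism.Build (Vch 0) int Vaug Vaug_additive.

Definition Vbd q : {additive Vch q.+1 -> Vch q} :=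
  match q with 0 => Vbd0 | q'.+1 => @VbdS q' end.

Lemma Vp_mulz i (x : int) : @din _ (fun _ : 'I_m.+1 => int) i x = Vp i *~ x.
Proof. by rewrite /Vp -(raddfMz (@din _ (fun _ : 'I_m.+1 => int) i)) /= intz. Qed.

Lemma Vch0_ext (W : zmodType) (f g : {additive Vch 0 -> W}) :
  (forall i, f (Vp i) = g (Vp i)) -> f =1 g.
Proof.
move=> E; apply: (@dsum_ext _ (fun _ : 'I_m.+1 => int)) => i x.
by rewrite Vp_mulz (raddfMz f) (raddfMz g) E.
Qed.

Lemma VchS_ext (W : zmodType) q (f g : {additive Vch q.+1 -> W}) :
  (forall i (x : X i q), f (Vs x) = g (Vs x)) -> f =1 g.
Proof. exact: dsum_ext. Qed.

Lemma Vbd0_s i (x : X i 0%N) : Vbd0 (Vs x) = (Vp (hi i) - Vp (lo i)) *~ aug x.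
Proof.
rewrite /Vbd0 (bigD1 i) //= [dcomp i _]dcomp_in big1 ?addr0 // => j ij.
by rewrite [dcomp j _]dcomp_out 1?eq_sym // raddf0.
Qed.

Lemma VbdS_s q i (x : X i q.+1) : VbdS (Vs x) = Vs (bd x).
Proof.
rewrite /VbdS (bigD1 i) //= [dcomp i _]dcomp_in big1 ?addr0 // => j ij.
by rewrite [dcomp j _]dcomp_out 1?eq_sym // !raddf0.
Qed.

Lemma Vaug_p i : Vaug (Vp i) = 1.
Proof.
rewrite /Vaug (bigD1 i) //= [dcomp i _]dcomp_in big1 ?addr0 // => j ij.
by rewrite [dcomp j _]dcomp_out 1?eq_sym.
Qed.

Lemma Vbd_bd q (x : Vch q.+2) : Vbd q (Vbd q.+1 x) = 0.
Proof.
case: q x => [|q] x.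
  apply: (VchS_ext (f := Vbd 0 \o Vbd 1) (g := \0)) => {x} i x /=.
  by rewrite VbdS_s Vbd0_s aug_bd.
apply: (VchS_ext (f := Vbd q.+1 \o Vbd q.+2) (g := \0)) => {x} i x /=.
by rewrite !VbdS_s bd_bd raddf0.
Qed.

Lemma Vaug_bd (x : Vch 1) : Vaug (Vbd 0 x) = 0.
Proof.
apply: (VchS_ext (f := Vaug \o Vbd 0) (g := \0)) => {x} i x /=.
by rewrite Vbd0_s raddfMz raddfB /= !Vaug_p subrr mul0rz.
Qed.

Lemma Vdst0 q : @Vdst q 0.
Proof. by case: q => [|q]; exists [::]; rewrite ?big_nil. Qed.

Lemma VdstD q (x y : Vch q) : Vdst x -> Vdst y -> Vdst (x + y).
Proof. by case: q x y => [|q] x y; apply: gen_submonoidD. Qed.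

Definition V_ob : adc := @Adc Vch Vbd Vaug Vbd_bd Vaug_bd Vdst Vdst0 VdstD.

End VObj.

Section VHom.
Variables (X Y : wreath adc) (f : Hom X Y).

(* [f_i^j], extended by 0 to the pairs [(i, j)] where it is not given *)
Definition Vfam i j q (x : X i q) : Y j q :=
  match pselect (in_block (wr_map f) i j) with
  | left h => wr_fam f h q x
  | right _ => 0
  end.

Definition Vhom0 (u : Vch X 0) : Vch Y 0 :=
  \sum_i Vp (wr_map f i) *~ dcomp i u.

Definition VhomS q (x : Vch X q.+1) : Vch Y q.+1 :=
  \sum_i \sum_j Vs (Vfam j (dcomp i x)).

Lemma VfamE i j q (x : X i q) (h : in_block (wr_map f) i j) :
  Vfam j x = wr_fam f h q x.
Proof.
by rewrite /Vfam; case: pselect => // h'; rewrite (bool_irrelevance h' h).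
Qed.

Lemma Vfam0 i j q (x : X i q) : ~~ in_block (wr_map f) i j -> Vfam j x = 0.
Proof. by rewrite /Vfam; case: pselect => // h /negP. Qed.

Lemma Vfam_additive i j q : zmod_morphism (@Vfam i j q).
Proof.
move=> x y; case: (boolP (in_block (wr_map f) i j)) => h.
  by rewrite !(VfamE _ h) raddfB.
by rewrite !(Vfam0 _ h) subr0.
Qed.
HB.instance Definition _ i j q :=
  GRing.isZmodMorphism.Build (X i q) (Y j q) (@Vfam i j q)
    (@Vfam_additive i j q).

Lemma Vfam_bd i j q (x : X i q.+1) : bd (Vfam j x) = Vfam j (bd x).
Proof.
case: (boolP (in_block (wr_map f) i j)) => h.
  by rewrite !(VfamE _ h) hmap_bd.
by rewrite !(Vfam0 _ h) raddf0.
Qed.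

Lemma Vhom0_additive : zmod_morphism Vhom0.
Proof.
move=> x y; rewrite /Vhom0 -sumrB; apply: eq_bigr => i _.
by rewrite raddfB mulrzBr.
Qed.
HB.instance Definition _ :=
  GRing.isZmodMorphism.Build (Vch X 0) (Vch Y 0) Vhom0 Vhom0_additive.

Lemma VhomS_additive q : zmod_morphism (@VhomS q).
Proof.
move=> x y; rewrite /VhomS -sumrB; apply: eq_bigr => i _.
rewrite -sumrB; apply: eq_bigr => j _.
by rewrite raddfB /= Vfam_additive raddfB.
Qed.
HB.instance Definition _ q :=
  GRing.isZmodMorphism.Build (Vch X q.+1) (Vch Y q.+1) (@VhomS q)
    (@VhomS_additive q).

Definition Vhom q : {additive Vch X q -> Vch Y q} :=
  match q with 0 => Vhom0 | q'.+1 => @VhomS q' end.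

Lemma Vhom0_p i : Vhom0 (Vp i) = Vp (wr_map f i).
Proof.
rewrite /Vhom0 (bigD1 i) //= [dcomp i _]dcomp_in big1 ?addr0 // => j ij.
by rewrite [dcomp j _]dcomp_out 1?eq_sym.
Qed.

Lemma VhomS_s i q (x : X i q) : VhomS (Vs x) = \sum_j Vs (Vfam j x).
Proof.
rewrite /VhomS (bigD1 i) //= [dcomp i _]dcomp_in [X in _ + X]big1 ?addr0 //.
move=> k ik; rewrite [dcomp k _]dcomp_out 1?eq_sym // big1 // => j _.
by rewrite !raddf0.
Qed.

Lemma Vhom_bd q (x : Vch X q.+1) :
  bd (a := V_ob Y) (Vhom q.+1 x) = Vhom q (bd (a := V_ob X) x).
Proof.
case: q x => [|q] x.
  apply: (VchS_ext (f := Vbd Y 0 \o Vhom 1) (g := Vhom 0 \o Vbd X 0)).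
  move=> {x} i x /=; rewrite VhomS_s Vbd0_s raddfMz raddfB /= !Vhom0_p.
  rewrite raddf_sum /= -(telescope_block _ (wr_mono f (_ : lo i <= hi i)%N)) //.
  rewrite mulrz_suml [RHS]big_mkcond; apply: eq_bigr => j _.
  rewrite Vbd0_s -[X in if X then _ else _]/(in_block (wr_map f) i j).
  by case: ifPn => h; rewrite ?(VfamE _ h) ?hmap_aug // (Vfam0 _ h) raddf0.
apply: (VchS_ext (f := Vbd Y q.+1 \o Vhom q.+2) (g := Vhom q.+1 \o Vbd X q.+1)).
move=> {x} i x /=; rewrite VhomS_s VbdS_s VhomS_s raddf_sum.
by apply: eq_bigr => j _; rewrite /= VbdS_s Vfam_bd.
Qed.

Lemma Vhom_aug (u : Vch X 0) : Vaug (Vhom 0 u) = Vaug u.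
Proof.
apply: (Vch0_ext (f := @Vaug Y \o Vhom 0) (g := @Vaug X)) => i /=.
by rewrite Vhom0_p !Vaug_p.
Qed.

Lemma Vhom_dst q (x : Vch X q) : Vdst x -> Vdst (Vhom q x).
Proof.
case: q x => [|q] x [s hs ->]; rewrite raddf_sum.
  apply: (@gen_submonoid_sum (Vch Y 0)) => u /hs[i ->].
  by apply: gen_submonoid_incl; exists (wr_map f i); rewrite /= Vhom0_p.
apply: (@gen_submonoid_sum (Vch Y q.+1)) => u /hs[i [y [hy ->]]] /=.
rewrite VhomS_s; apply: gen_submonoid_sum => j _.
apply: gen_submonoid_incl; exists j, (Vfam j y); split=> //.
case: (boolP (in_block (wr_map f) i j)) => h.
  by rewrite (VfamE _ h); apply: hmap_dst.
by rewrite (Vfam0 _ h); apply: dst0.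
Qed.

Definition V_hom : Hom (V_ob X) (V_ob Y) :=
  @AdcHom (V_ob X) (V_ob Y) Vhom Vhom_bd Vhom_aug Vhom_dst.

End VHom.

Lemma V_hom1 X : V_hom (idm X) = idm (V_ob X).
Proof.
apply: adc_hom_eq => -[|q] x.
  apply: (Vch0_ext (f := Vhom (idm X) 0) (g := idfun)) => i /=.
  by rewrite Vhom0_p.
apply: (VchS_ext (f := Vhom (idm X) q.+1) (g := idfun)) => i {}x /=.
rewrite VhomS_s (bigD1 i) //= big1 ?addr0 => [|j ij].
  have h : in_block (wr_map (idm X)) i i by rewrite /in_block /= leqnn ltnSn.
  by rewrite (VfamE _ h) (wr_idE h).
rewrite Vfam0 ?raddf0 //; apply/negP => /in_block_id E.
by rewrite E eqxx in ij.
Qed.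

Lemma V_homM X Y Z (g : Hom Y Z) (f : Hom X Y) :
  V_hom (mcomp g f) = mcomp (V_hom g) (V_hom f).
Proof.
apply: adc_hom_eq => -[|q] x.
  apply: (Vch0_ext (f := Vhom (mcomp g f) 0) (g := Vhom g 0 \o Vhom f 0)) => i /=.
  by rewrite !Vhom0_p.
apply: (VchS_ext (f := Vhom (mcomp g f) q.+1) (g := Vhom g q.+1 \o Vhom f q.+1)).
move=> i {}x /=; rewrite !VhomS_s raddf_sum /=.
under [RHS]eq_bigr do rewrite VhomS_s.
rewrite exchange_big /=; apply: eq_bigr => k _.
rewrite -raddf_sum; congr Vs.
case: (boolP (in_block (wr_map (mcomp g f)) i k)) => h; last first.
  rewrite Vfam0 // big1 // => j _.
  have [h1|h1] := boolP (in_block (wr_map f) i j); last first.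
    by rewrite (Vfam0 _ h1) raddf0.
  rewrite Vfam0 //; apply: contra h => h2.
  exact: (@in_block_comp _ _ _ (wr_map f) (wr_map g) (@wr_mono _ _ _ g)
    _ _ _ h1 h2).
have h1 := @wr_midl _ _ _ _ g f _ _ h.
have h2 := @wr_midr _ _ _ _ g f _ _ h.
rewrite (VfamE _ h) (wr_compE h1 h2 h : wr_fam (mcomp g f) h = _).
rewrite (bigD1 (wr_mid h)) //= big1 ?addr0 => [|j jm].
  by rewrite (VfamE _ h1) (VfamE _ h2).
have [h3|h3] := boolP (in_block (wr_map g) j k); last by rewrite (Vfam0 _ h3).
by rewrite (in_block_uniq (@wr_mono _ _ _ g) h3 h2) eqxx in jm.
Qed.

Definition V : functor (wreath adc) adc := Functor V_hom1 V_homM.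

Lemma existT_inj (A : Type) (P : A -> Type) x (p q : P x) :
  existT P x p = existT P x q -> p = q.
Proof.
by move=> E; have := projT2_eq E; rewrite (Prop_irrelevance (projT1_eq E) erefl).
Qed.

Section BasisTheory.
Variable W : zmodType.
Implicit Types (B : set W) (x y z : W) (s t u : seq W).

Lemma sum_count u s : uniq u -> {subset s <= u} ->
  \sum_(b <- s) b = \sum_(b <- u) b *~ (count_mem b s)%:Z.
Proof.
move=> uu; elim: s => [|a s IH] su; first by rewrite big_nil big1.
rewrite big_cons IH => [|b hb]; last by apply: su; rewrite inE hb orbT.
under [RHS]eq_bigr do rewrite /= PoszD mulrzDr.
rewrite big_split /=; congr (_ + _).
rewrite (bigD1_seq a) //=; last by apply: su; rewrite inE eqxx.
by rewrite eqxx mulr1z big1 ?addr0 // => b ba; rewrite eq_sym (negPf ba).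
Qed.

Lemma zbasis_perm B s t : zbasis B -> all_in B s -> all_in B t ->
  \sum_(b <- s) b = \sum_(b <- t) b -> perm_eq s t.
Proof.
move=> [_ ind] hs ht E.
pose u := undup (s ++ t).
have hu : all_in B u by move=> b; rewrite mem_undup mem_cat => /orP[/hs|/ht].
have := ind u (fun b => (count_mem b s)%:Z - (count_mem b t)%:Z) (undup_uniq _) hu.
have -> : \sum_(b <- u) b *~ ((count_mem b s)%:Z - (count_mem b t)%:Z) = 0.
  under eq_bigr do rewrite mulrzBr.
  rewrite sumrB -!sum_count ?undup_uniq ?E ?subrr // => b hb.
    by rewrite mem_undup mem_cat hb orbT.
  by rewrite mem_undup mem_cat hb.
move=> /(_ erefl) H; apply/allP => b hb /=.
have bu : b \in u by rewrite mem_undup.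
by have /subr0_eq[->] := H b bu.
Qed.

Lemma zbasis_neq0 B b : zbasis B -> B b -> b <> 0.
Proof.
move=> hB Bb b0.
have /perm_size // : perm_eq [:: b] [::].
by apply: (zbasis_perm hB) => //; rewrite ?big_seq1 ?big_nil // => a /[!inE] /eqP ->.
Qed.

Lemma is_termP B a s : zbasis B -> all_in B s ->
  is_term B a (\sum_(b <- s) b) -> a \in s.
Proof.
move=> hB hs [t [ht at_ E]].
by rewrite (perm_mem (zbasis_perm hB hs ht E)).
Qed.

Lemma is_parts_uniq B x p p' : zbasis B ->
  is_parts B x p -> is_parts B x p' -> p = p'.
Proof.
move=> hB [s [t [hs ht st -> /= E]]] [s' [t' [hs' ht' st' -> /= E']]].
have P : perm_eq (s ++ t') (s' ++ t).
  apply: (zbasis_perm hB) => [b|b|].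
  - by rewrite mem_cat => /orP[/hs|/ht'].
  - by rewrite mem_cat => /orP[/hs'|/ht].
  by rewrite !big_cat /=; apply/eqP; rewrite -subr_eq addrAC -E E' subrK.
have C b : count_mem b s = count_mem b s' /\ count_mem b t = count_mem b t'.
  have := permP P (pred1 b); rewrite !count_cat.
  have [bs|/count_memPn ->] := boolP (b \in s).
    have /count_memPn -> := st _ bs.
    have [bs'|/count_memPn ->] := boolP (b \in s').
      by have /count_memPn -> := st' _ bs'; rewrite !addn0.
    by move/eqP; rewrite addn_eq0 => /andP[/eqP -> /eqP ->].
  have [bs'|/count_memPn ->] := boolP (b \in s').
    have /count_memPn -> := st' _ bs'; move/esym/eqP.
    by rewrite addn_eq0 => /andP[/eqP -> /eqP ->].
  by rewrite !add0n.
have P1 : perm_eq s s' by apply/allP => b _; apply/eqP; case: (C b).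
have P2 : perm_eq t t' by apply/allP => b _; apply/eqP; case: (C b).
by rewrite (perm_big _ P1) (perm_big _ P2).
Qed.

Lemma zspan_parts B s (c : W -> int) : all_in B s ->
  exists p, is_parts B (\sum_(b <- s) b *~ c b) p.
Proof.
move=> hs.
pose f (d : W -> int) := flatten [seq nseq `|d b|%N b | b <- s & (0 < d b)].
have hf d b : b \in f d -> b \in s /\ 0 < d b.
  move/flattenP => [l /mapP[a]]; rewrite mem_filter => /andP[da sa] ->.
  by rewrite mem_nseq => /andP[_ /eqP ->].
have sf d : \sum_(b <- f d) b = \sum_(b <- s | 0 < d b) b *~ d b.
  rewrite big_flatten big_map big_filter; apply: eq_bigr => b db.
  by rewrite big_nseq iter_addr_0 pmulrn gtz0_abs.
exists (\sum_(b <- f c) b, \sum_(b <- f (fun b => - c b)) b).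
exists (f c), (f (fun b => - c b)); split=> //.
- by move=> b /hf[/hs].
- by move=> b /hf[/hs].
- move=> b /hf[_ cb]; apply/negP => /hf[_]; rewrite oppr_gt0.
  by rewrite ltNge (ltW cb).
rewrite !sf /= (bigID (fun b => 0 < c b)) /=; congr (_ + _).
rewrite (bigID (fun b => 0 < - c b)) /= [X in _ + X]big1 ?addr0; last first.
  move=> b /andP[h1 h2]; suff -> : c b = 0 by [].
  by apply/eqP; rewrite eq_le leNgt h1 /= -oppr_le0 leNgt.
rewrite -sumrN; apply: eq_big => b.
  by rewrite oppr_gt0; case: ltgtP.
by move=> _; rewrite mulrNz opprK.
Qed.

Lemma partsP B x : zbasis B -> is_parts B x (parts B x).
Proof.
move=> hB; rewrite /parts; apply: xgetPex.
by have [/(_ x)[s [c [hs ->]]] _] := hB; apply: zspan_parts.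
Qed.

Lemma parts_eq B x p : zbasis B -> is_parts B x p -> parts B x = p.
Proof. by move=> hB; apply: (is_parts_uniq hB); apply: partsP. Qed.

Lemma zspanP B x :
  (exists s (c : W -> int), all_in B s /\ x = \sum_(b <- s) b *~ c b) <->
  (exists y z, [/\ gen_submonoid B y, gen_submonoid B z & x = y - z]).
Proof.
split=> [[s [c [hs ->]]]|[_ [_ [[s hs ->] [t ht ->] ->]]]].
  have [_ [s' [t' [hs' ht' _ -> ->]]]] := zspan_parts c hs.
  by do 2!eexists; split; [exists s'|exists t'|].
exists (undup (s ++ t)), (fun b => (count_mem b s)%:Z - (count_mem b t)%:Z).
split=> [b|]; first by rewrite mem_undup mem_cat => /orP[/hs|/ht].
under [RHS]eq_bigr do rewrite mulrzBr.
rewrite sumrB -!sum_count ?undup_uniq // => b hb.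
  by rewrite mem_undup mem_cat hb orbT.
by rewrite mem_undup mem_cat hb.
Qed.

End BasisTheory.

Section DirectSumBasis.
Variables (I : finType) (T : I -> zmodType) (B : forall i, set (T i)).
Hypothesis hB : forall i, zbasis (@B i).

Definition dB : set (dsum T) :=
  fun u => exists i (b : T i), B b /\ u = din b.

Lemma dB_gen i (x : T i) : gen_submonoid (@B i) x -> gen_submonoid dB (din x).
Proof.
move=> [s hs ->]; rewrite raddf_sum; apply: gen_submonoid_sum => b hb.
by apply: gen_submonoid_incl; exists i, b; split=> //; apply: hs.
Qed.

Lemma dB_zbasis : zbasis dB.
Proof.
split=> [u|s c us hs E b0 hb0].
  apply/zspanP; rewrite (dsum_sum u).
  have H i : exists yz : T i * T i, [/\ gen_submonoid (@B i) yz.1,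
      gen_submonoid (@B i) yz.2 & dcomp i u = yz.1 - yz.2].
    by have [/(_ (dcomp i u)) /zspanP[y [z ?]] _] := hB i; exists (y, z).
  pose g i := sval (cid (H i)).
  have hg i := svalP (cid (H i)).
  exists (\sum_i din (g i).1), (\sum_i din (g i).2); split.
  - by apply: gen_submonoid_sum => i _; apply: dB_gen; case: (hg i).
  - by apply: gen_submonoid_sum => i _; apply: dB_gen; case: (hg i).
  rewrite -sumrB; apply: eq_bigr => i _; rewrite -raddfB /=.
  by case: (hg i) => _ _ ->.
have [i [b [Bb Eb]]] := hs _ hb0.
have block v : v \in s -> v != din (dcomp i v) -> dcomp i v = 0.
  move=> /hs[j [a [_ ->]]]; have [<-|ji _] := eqVneq j i; last exact: dcomp_out.
  by rewrite dcomp_in eqxx.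
have blockB v : v \in s -> v == din (dcomp i v) -> B (dcomp i v).
  move=> /hs[j [a [Ba ->]]]; have [<-|ji] := eqVneq j i; first by rewrite dcomp_in.
  rewrite (dcomp_out _ ji) raddf0 => /eqP a0.
  by have := zbasis_neq0 (hB j) Ba; case; apply: din_inj; rewrite a0 raddf0.
pose s' := [seq dcomp i v | v <- s & v == din (dcomp i v)].
have us' : uniq s'.
  rewrite map_inj_in_uniq ?filter_uniq // => v w.
  rewrite !mem_filter => /andP[/eqP Ev _] /andP[/eqP Ew _] Evw.
  by rewrite Ev Ew Evw.
have hs' : all_in (@B i) s'.
  by move=> a /mapP[v]; rewrite mem_filter => /andP[v1 v2] ->; apply: blockB.
have := (hB i).2 s' (fun a => c (din a)) us' hs'.
have -> : \sum_(a <- s') a *~ c (din a) = 0.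
  rewrite big_map big_filter.
  transitivity (dcomp i (\sum_(v <- s) v *~ c v)); last by rewrite E raddf0.
  rewrite raddf_sum [RHS](bigID (fun v => v == din (dcomp i v))) /=.
  rewrite [X in _ = _ + X]big_seq_cond [X in _ = _ + X]big1 ?addr0.
    by apply: eq_bigr => v /eqP Ev; rewrite raddfMz /= -Ev.
  by move=> v /andP[v1 v2]; rewrite raddfMz /= block // mul0rz.
move=> /(_ erefl b); rewrite Eb; apply.
by apply/mapP; exists b0; rewrite ?mem_filter ?hb0 Eb dcomp_in ?eqxx.
Qed.

Lemma dB_parts i (x : T i) p : is_parts (@B i) x p ->
  is_parts dB (din x) (din p.1, din p.2).
Proof.
have D s : all_in (@B i) s -> all_in dB [seq @din _ T i b | b <- s].
  by move=> hs _ /mapP[b /hs ? ->]; exists i, b.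
move=> [s [t [hs ht st -> ->]]].
exists [seq @din _ T i b | b <- s], [seq @din _ T i b | b <- t]; split.
- exact: D.
- exact: D.
- by move=> _ /mapP[b bs ->]; rewrite mem_map ?st //; apply: din_inj.
- by rewrite !big_map /= !raddf_sum.
by rewrite raddfB.
Qed.

Lemma dB_term i (x : T i) a : gen_submonoid (@B i) x ->
  is_term dB a (din x) -> exists a', [/\ a = din a', B a' & is_term (@B i) a' x].
Proof.
move=> [s hs ->]; rewrite raddf_sum /= -(big_map (@din _ T i) xpredT id).
move/(is_termP dB_zbasis) => /(_ _)/mapP[].
  by move=> _ /mapP[b /hs ? ->]; exists i, b.
by move=> b bs ->; exists b; split=> //; [apply: hs | exists s].
Qed.

End DirectSumBasis.

Lemma zbasis_int1 : zbasis (fun z : int => z = 1).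
Proof.
split=> [x|s c us hs E b bs].
  by exists [:: 1], (fun=> x); split=> [b /[!inE] /eqP //|]; rewrite big_seq1 intz.
have Es : s = [:: 1].
  case: s us hs bs {E} => // a [|a' s] us hs _; first by rewrite (hs a) ?inE.
  by move: us; rewrite (hs a) ?inE ?eqxx // (hs a') ?inE ?eqxx ?orbT.
by move: bs E; rewrite Es inE big_seq1 intz => /eqP ->.
Qed.

Section VBasis.
Variables (X : wreath adc) (B : forall i q, set (X i q)).
Hypothesis Bbasis : forall i, is_basis (@B i).
Hypothesis Bunital : forall i, unital (@B i).
Hypothesis Bloop_free : forall i, loop_free (@B i).
Local Notation m := (wr_len X).
Local Notation VX := (V_ob X).

Definition VB (q : nat) : set (VX q) :=
  match q with
  | 0 => fun u => exists i, u = Vp i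
  | q'.+1 => fun u => exists i (b : X i q'), B b /\ u = Vs b
  end.

Lemma VB_zbasis q : zbasis (@VB q).
Proof.
case: q => [|q]; last exact: (@dB_zbasis _ (fun i => X i q) (fun i => @B i q)
  (fun i => (Bbasis i q).1)).
have := @dB_zbasis _ _ _ (fun _ : 'I_m.+1 => zbasis_int1).
congr zbasis; apply: funext => u; apply: propext.
by split=> [[i [_ [-> ->]]]|[i ->]]; exists i => //; exists 1.
Qed.

Lemma VB_basis : is_basis VB.
Proof.
move=> q; split; first exact: VB_zbasis.
case: q => [|q] //; apply: funext => u; apply: propext; split.
  case=> s hs ->; apply: (@gen_submonoid_sum (VX q.+1)) => v /hs[i [x [hx ->]]].
  rewrite (Bbasis i q).2 in hx; exact: (dB_gen (B := fun i => @B i q)).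
case=> s hs ->; exists s => // v /hs[i [b [hb ->]]]; exists i, b; split=> //.
by rewrite (Bbasis i q).2; apply: gen_submonoid_incl.
Qed.

Definition Vh i (x : hchain (X i)) : hchain VX :=
  @hch VX (projT1 x).+1 (Vs (projT2 x)).

Lemma basis_eltV b : basis_elt VB b ->
  (exists i, b = @hch VX 0 (Vp i)) \/
  (exists i (b' : hchain (X i)), basis_elt (@B i) b' /\ b = Vh b').
Proof.
case: b => [[|q] b]; rewrite /basis_elt /=.
  by case=> i ->; left; exists i.
by case=> i [b' [hb ->]]; right; exists i, (existT _ q b').
Qed.

Lemma Vh_basis i (b : hchain (X i)) : basis_elt (@B i) b -> basis_elt VB (Vh b).
Proof. by case: b => q b hb; exists i, b. Qed.

Lemma deg_bdpart (K : adc_ob) (C : forall q, set (K q)) e x :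
  deg (bdpart C e x) = (deg x).-1.
Proof. by case: x => [[|q] x]. Qed.

Lemma deg_iter (K : adc_ob) (C : forall q, set (K q)) e k x :
  deg (iter k (bdpart C e) x) = (deg x - k)%N.
Proof. by elim: k => [|k IH] /=; rewrite ?subn0 // deg_bdpart IH subnS. Qed.

Lemma gen_bdpart (K : adc_ob) (C : forall q, set (K q)) e x :
  is_basis C -> (0 < deg x)%N ->
  gen_submonoid (@C _) (projT2 (bdpart C e x)).
Proof.
case: x => [[|q] x] //= hC _.
have [s [t [hs ht _ -> _]]] := partsP (bd x) (hC q).1.
by case: e; [exists s|exists t].
Qed.

Lemma bdpart_Vh i e (x : hchain (X i)) : (0 < deg x)%N ->
  bdpart VB e (Vh x) = Vh (bdpart (@B i) e x).
Proof.
case: x => [[|q] x] //= _; rewrite VbdS_s.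
have := @dB_parts _ (fun i => X i q) (fun i => @B i q) i _ _
  (partsP (bd x) (Bbasis i q).1).
by move=> /(parts_eq (VB_zbasis q.+1)) ->; case: e.
Qed.

Lemma iter_Vh i e k (x : hchain (X i)) : (k <= deg x)%N ->
  iter k (bdpart VB e) (Vh x) = Vh (iter k (bdpart (@B i) e) x).
Proof.
elim: k => [|k IH] //= hk.
by rewrite IH ?(ltnW hk) // bdpart_Vh // deg_iter subn_gt0.
Qed.

Lemma Vp_inj : injective (@Vp X).
Proof.
move=> i j /(congr1 (@dcomp _ (fun _ : 'I_m.+1 => int) i)).
rewrite [LHS]dcomp_in; have [//|ij] := eqVneq j i.
by rewrite [RHS](dcomp_out _ ij).
Qed.

Lemma bdpart_Vh0 i e (x : hchain (X i)) : deg x = 0%N -> haug x = 1 ->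
  bdpart VB e (Vh x) = @hch VX 0 (Vp (if e then hi i else lo i)).
Proof.
case: x => [[|q] x] //= _ hx; rewrite Vbd0_s hx mulr1z.
have := parts_eq (p := (Vp (hi i), Vp (lo i))) (VB_zbasis 0) => ->.
  by case: e.
exists [:: Vp (hi i)], [:: Vp (lo i)]; split=> //.
- by move=> b /[!inE] /eqP ->; exists (hi i).
- by move=> b /[!inE] /eqP ->; exists (lo i).
- move=> b /[!inE] /eqP ->; apply/eqP => /Vp_inj /(congr1 val) /= /eqP.
  by rewrite -[X in X == _]addn1 -[X in _ == X]addn0 eqn_add2l.
by rewrite !big_seq1.
Qed.

Lemma iter_full i e (b : hchain (X i)) : basis_elt (@B i) b ->
  iter (deg b).+1 (bdpart VB e) (Vh b) =
  @hch VX 0 (Vp (if e then hi i else lo i)).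
Proof.
move=> hb; rewrite iterS iter_Vh // bdpart_Vh0 ?deg_iter ?subnn //.
by have [] := Bunital hb; case: e.
Qed.

Lemma VB_unital : unital VB.
Proof.
move=> b /basis_eltV[[i ->]|[i [b' [hb ->]]]].
  by rewrite /= Vaug_p.
by rewrite -[deg (Vh b')]/(deg b').+1 !(iter_full _ hb) /= !Vaug_p.
Qed.

Lemma hterm_Vp a i : is_hterm VB a (@hch VX 0 (Vp i)) -> a = @hch VX 0 (Vp i).
Proof.
case=> q [a' [x' [-> E]]].
have Eq := congr1 (@deg VX) E; rewrite /= in Eq; subst q.
have Ei : Vp i = \sum_(b <- [:: Vp i]) b :> VX 0%N by rewrite big_seq1.
rewrite -(existT_inj E) => h; rewrite Ei in h.
have := is_termP (VB_zbasis 0) _ h; rewrite !inE => /(_ _)/eqP -> //.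
by move=> b /[!inE] /eqP ->; exists i.
Qed.

Lemma hterm_Vh a i (z : hchain (X i)) : gen_submonoid (@B i _) (projT2 z) ->
  is_hterm VB a (Vh z) ->
  exists a' : hchain (X i),
    [/\ a = Vh a', basis_elt (@B i) a' & is_hterm (@B i) a' z].
Proof.
case: z => r z hz [q [a' [x' [-> E]]]].
have Eq := congr1 (@deg VX) E; rewrite /= in Eq; subst q.
rewrite -(existT_inj E) => h.
have [c [-> hc hcz]] := @dB_term _ (fun i => X i r) (fun i => @B i r)
  (fun i => (Bbasis i r).1) i _ _ hz h.
by exists (hch c); split=> //; exists r, c, z.
Qed.

Lemma Vh_inj i j (a : hchain (X i)) (b : hchain (X j)) :
  basis_elt (@B i) a -> Vh a = Vh b ->
  existT (fun i => hchain (X i)) i a = existT _ j b.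
Proof.
case: a b => q x [r y] hx E.
have [Eq] := congr1 (@deg VX) E; subst r.
have {}E := existT_inj E.
have [ij|ij] := eqVneq j i.
  by subst j; rewrite /= in E; rewrite (@din_inj _ (fun i => X i q) _ _ _ E).
have := congr1 (@dcomp _ (fun i => X i q) i) E.
rewrite [LHS]dcomp_in [RHS](dcomp_out _ ij) => x0.
by have := zbasis_neq0 (Bbasis i q).1 hx.
Qed.

(* Position of a basis element in [p^0, sK^1, p^1, ..., sK^m, p^m]. *)
Definition Vpos (x : hchain VX) : nat :=
  match x with
  | existT 0 u => (oapp (@nat_of_ord _) 0 [pick i | @dcomp _ (fun _ : 'I_m.+1 => int) i u != 0%R]).*2
  | existT q.+1 u => (oapp (@nat_of_ord _) 0 [pick i | @dcomp _ (fun i => X i q) i u != 0%R]).*2.+1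
  end%N.

Lemma Vpos_p i : Vpos (@hch VX 0 (Vp i)) = i.*2.
Proof.
rewrite /=; case: pickP => [j|/(_ i)]; last by rewrite [dcomp _ _]dcomp_in.
by have [-> //|ij] := eqVneq i j; rewrite [dcomp _ _](dcomp_out _ ij) eqxx.
Qed.

Lemma Vpos_h i (b : hchain (X i)) : basis_elt (@B i) b -> Vpos (Vh b) = i.*2.+1.
Proof.
case: b => q b hb; rewrite /=; case: pickP => [j|/(_ i)].
  have [-> //|] := eqVneq j i; rewrite eq_sym => ij.
  by rewrite [dcomp _ _](dcomp_out _ ij) eqxx.
rewrite [dcomp _ _]dcomp_in => /negbFE/eqP b0.
by have := zbasis_neq0 (Bbasis i q).1 hb.
Qed.

Lemma VB_loop_free0 : exists lt : hchain VX -> hchain VX -> Prop,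
    [/\ forall a, basis_ge VB 0 a -> ~ lt a a,
        forall a b c, basis_ge VB 0 a -> basis_ge VB 0 b -> basis_ge VB 0 c ->
          lt a b -> lt b c -> lt a c,
        forall a b, basis_ge VB 0 a -> basis_ge VB 0 b -> (0 < deg b)%N ->
          is_hterm VB a (iter (deg b - 0) (bdpart VB false) b) -> lt a b
      & forall a b, basis_ge VB 0 a -> basis_ge VB 0 b -> (0 < deg a)%N ->
          is_hterm VB b (iter (deg a - 0) (bdpart VB true) a) -> lt a b].
Proof.
exists (fun a b => (Vpos a < Vpos b)%N); split.
- by move=> a _; rewrite ltnn.
- by move=> a b c _ _ _; apply: ltn_trans.
- move=> a b _ [/basis_eltV[[i ->]|[i [b' [hb ->]]]] _] // _.
  rewrite subn0 [deg _]/= -/(deg b') (iter_full _ hb) => /hterm_Vp ->.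
  by rewrite Vpos_p Vpos_h.
move=> a b [/basis_eltV[[i ->]|[i [a' [ha ->]]]] _] // _ _.
rewrite subn0 [deg _]/= -/(deg a') (iter_full _ ha) => /hterm_Vp ->.
by rewrite Vpos_p Vpos_h // doubleS.
Qed.

Lemma gen_iter i e k (b : hchain (X i)) : (0 < k <= deg b)%N ->
  gen_submonoid (@B i _) (projT2 (iter k (bdpart (@B i) e) b)).
Proof.
case: k => // k hk; rewrite iterS; apply: gen_bdpart => //.
by rewrite deg_iter subn_gt0.
Qed.

Lemma VB_loop_free : loop_free VB.
Proof.
move=> [|q]; first exact: VB_loop_free0.
pose lti i := sval (cid (Bloop_free i q)).
have hlti i := svalP (cid (Bloop_free i q)).
exists (fun u v => exists i (a b : hchain (X i)),
  [/\ u = Vh a, v = Vh b, basis_ge (@B i) q a, basis_ge (@B i) q b & lti i a b]).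
split.
- move=> _ _ [i [a [b [-> E [ha qa] hb]]]].
  rewrite -(existT_inj (Vh_inj ha E)).
  by case: (hlti i) => irr _ _ _; apply: irr.
- move=> _ b _ _ _ _ [i [a [b1 [-> -> ga gb l1]]]] [j [b2 [c [E -> gb' gc l2]]]].
  have E' := Vh_inj gb.1 E; have ij := projT1_eq E'; rewrite /= in ij; subst j.
  rewrite -(existT_inj E') in l2.
  exists i, a, c; split=> //.
  by case: (hlti i) => _ tr _ _; apply: tr l1 l2.
- move=> a b [ha qa] [/basis_eltV[[i ->]|[i [b' [hb ->]]]] qb] //.
  rewrite -[deg (Vh b')]/(deg b').+1 ltnS subSS => qb'.
  rewrite iter_Vh ?leq_subr // => /hterm_Vh[].
    by apply: gen_iter; rewrite subn_gt0 qb' leq_subr.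
  move=> a' [Ea ha' t]; subst a; exists i, a', b'.
  have ga : basis_ge (@B i) q a' by split.
  have gb : basis_ge (@B i) q b' by split=> //; apply: ltnW.
  by split=> //; case: (hlti i) => _ _ h _; apply: h.
move=> a b [/basis_eltV[[i ->]|[i [a' [ha ->]]]] qa] [hb qb] //.
rewrite -[deg (Vh a')]/(deg a').+1 ltnS subSS => qa'.
rewrite iter_Vh ?leq_subr // => /hterm_Vh[].
  by apply: gen_iter; rewrite subn_gt0 qa' leq_subr.
move=> b' [Eb hb' t]; subst b; exists i, a', b'.
have ga : basis_ge (@B i) q a' by split=> //; apply: ltnW.
have gb : basis_ge (@B i) q b' by split.
by split=> //; case: (hlti i) => _ _ _ h; apply: h.
Qed.

End VBasis.

Lemma V_in_Phi (X : wreath adc) : (forall i, in_Phi (X i)) -> in_Phi (V X).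
Proof.
move=> h; split.
  exists 0%N, (Vp ord0) => E; have := congr1 (@Vaug X) E.
  by rewrite Vaug_p raddf0.
have H i := cid (h i).2.
exists (VB (fun i => sval (H i))); split.
- by apply: VB_basis => i; case: (svalP (H i)).
- by apply: VB_unital => i; case: (svalP (H i)).
by apply: VB_loop_free => i; case: (svalP (H i)).
Qed.

Definition V_incl : functor (wreath Phi) adc :=
  functor_comp V (wreath_functor (full_incl in_Phi)).

Definition V_Phi : functor (wreath Phi) Phi :=
  functor_lift (P := in_Phi) (F := V_incl)
    (fun X => V_in_Phi (X := wreath_functor (full_incl in_Phi) X)
      (fun i => svalP (X i))).

(* Main.v *)
From HB Require Import structures.
From mathcomp Require Import all_boot all_order all_algebra.
From mathcomp Require Import boolp classical_sets.
Require Import Defs.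

Set Implicit Arguments.
Unset Strict Implicit.
Unset Printing Implicit Defensive.

Import Order.TTheory GRing.Theory Num.Theory.
Local Open Scope ring_scope.

(** Faithfulness is a matter of reading off: a morphism [(phi, f)] is recovered
    from [V(phi, f)], since [p^i] goes to [p^(phi i)] and the [j]-th component
    of the image of [s x] is [f_i^j x] ([Vcomp_V_hom]).

    For fullness, let [F : V(m, K) -> V(n, L)].  The chain [F p^i] is a sum of
    some [p^k], and the number of summands is its augmentation, which is 1; so
    [F p^i = p^(phi i)] for some [phi] ([hmap_Vp]).  Let [F_i^j : K^i -> L^j]
    be the components of [F] on [s K^i] ([Vcomp]); they commute with the
    boundaries and preserve the distinguished submonoids, and what has to be
    shown is that [phi] is monotone, that [F_i^j] preserves augmentations for
    [j] in the [i]-th block of [phi], and that [F_i^j = 0] otherwise.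

    All three follow from the boundary of [s x] for [x] of degree 0.  Cutting
    the chain of points [p^0, ..., p^n] in the [j]-th gap, that is, adding up
    the coefficients to the right of this gap, turns the boundary of a chain of
    degree 1 into the augmentation of its [j]-th component ([cut_Vbd0]).  Hence
    [aug (F_i^j x)] is [aug x] times 1, 0 or -1, according to the sides of the
    gap on which the end points of the [i]-th block lie ([Vcomp_aug]).  The
    value -1 is impossible, because [K^i] has a basis element of degree 0, of
    augmentation 1 by unitality, while distinguished chains of degree 0 have
    nonnegative augmentation; so [phi] is monotone ([phi_step]).

    Outside the block, [F_i^j] is a positive chain map which kills
    augmentations, and such a map is zero ([chain_map_aug0]): in degree 0
    because a distinguished chain of augmentation 0 is zero, and then by
    induction on the degree, because a distinguished cycle of positive degree
    is zero in a complex with a loop-free unital basis ([positive_cycle_eq0]). *)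

(** * Distinguished chains in complexes with loop-free unital bases *)

Lemma maximal_in (T : eqType) (lt : T -> T -> Prop) (P : T -> Prop) (s : seq T) :
  (forall a, P a -> ~ lt a a) ->
  (forall a b c, P a -> P b -> P c -> lt a b -> lt b c -> lt a c) ->
  (forall a, a \in s -> P a) -> s <> [::] ->
  exists2 c, c \in s & forall b, b \in s -> ~ lt c b.
Proof.
move=> irr tr; elim: s => // a s IH Ps _.
have Pa : P a by apply: Ps; rewrite inE eqxx.
have Ps' b : b \in s -> P b by move=> bs; apply: Ps; rewrite inE bs orbT.
have [s0|/eqP s0] := eqVneq s [::].
  by exists a; rewrite s0 ?inE // => b /[!inE] /eqP ->; apply: irr.
have [c cs cmax] := IH Ps' s0.
have [ca|ca] := pselect (lt c a).
  exists a; first by rewrite inE eqxx.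
  move=> b /[!inE] /predU1P[->|bs]; first exact: irr.
  by move=> ab; apply: (cmax b bs); apply: tr ca ab => //; apply: Ps'.
exists c; first by rewrite inE cs orbT.
by move=> b /[!inE] /predU1P[->|]; last exact: cmax.
Qed.

Lemma zbasis_inhab (W : zmodType) (C : set W) (x : W) :
  zbasis C -> x <> 0 -> exists b, C b.
Proof.
move=> [/(_ x)[[|b s] [c [hs ->]]] _]; first by rewrite big_nil.
by move=> _; exists b; apply: hs; rewrite inE eqxx.
Qed.

Section LoopFreeUnital.
Variables (K : adc) (B : forall q, set (K q)).
Hypothesis hB : is_basis B.
Hypothesis hU : unital B.

Lemma aug_basis (b : K 0%N) : B b -> aug b = 1.
Proof. by move=> Bb; have [] := @hU (hch b) Bb. Qed.

Lemma aug_sum_basis (s : seq (K 0%N)) : all_in (@B 0%N) s ->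
  aug (\sum_(b <- s) b) = (size s)%:Z.
Proof.
move=> hs; rewrite raddf_sum big_seq (eq_bigr (fun=> 1)); last first.
  by move=> b /hs; apply: aug_basis.
by rewrite -big_seq big_const_seq count_predT iter_addr_0 natz.
Qed.

Lemma aug_dst_ge0 (x : K 0%N) : dst x -> 0 <= aug x.
Proof. by rewrite (hB 0).2 => -[s hs ->]; rewrite aug_sum_basis. Qed.

Lemma aug_dst_eq0 (x : K 0%N) : dst x -> aug x = 0 -> x = 0.
Proof.
rewrite (hB 0).2 => -[s hs ->]; rewrite aug_sum_basis // => -[/size0nil ->].
by rewrite big_nil.
Qed.

(** Unitality forces degree 0 to be nontrivial: [(∂^-)^q b] lies there and has
    augmentation 1 for any basis element [b] of degree [q]. *)
Lemma exists_basis0 : (exists q (x : K q), x <> 0) -> exists b : K 0%N, B b.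
Proof.
move=> [q [x x0]]; have [b Bb] := zbasis_inhab (hB q).1 x0.
have [] := @hU (hch b) Bb; case: (iter _ _ _) => -[|r] // y /= y1 _.
by apply: (@zbasis_inhab _ _ y (hB 0).1) => y0; rewrite y0 raddf0 in y1.
Qed.

Lemma parts0 q : parts (@B q) 0 = (0, 0).
Proof.
apply: parts_eq; first exact: (hB q).1.
by exists [::], [::]; split; rewrite ?big_nil ?subr0.
Qed.

Lemma haug_iter_bdpart0 e k q : haug (iter k (bdpart B e) (hch (0 : K q))) = 0.
Proof.
elim: k q => [|k IH] q; first by case: q => [|q] //=; rewrite raddf0.
rewrite iterSr; suff -> : bdpart B e (hch (0 : K q)) = hch (0 : K q.-1) by [].
by case: q {IH} => [|q] //=; rewrite raddf0 parts0; case: e.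
Qed.

(** Otherwise the iterated [(∂^+)^(q+1) b] would be zero as well, against its
    augmentation being 1. *)
Lemma bdpart_neq0 q (b : K q.+1) : B b -> (parts (@B q) (bd b)).1 <> 0.
Proof.
move=> Bb E; have [_] := @hU (hch b) Bb.
by rewrite [deg _]/= iterSr /= E haug_iter_bdpart0.
Qed.

Hypothesis hL : loop_free B.

(** In a nonempty sum of basis elements choose a summand [c] that is maximal for
    [<_q].  Some basis element [a] occurs in [∂^+ c]; as the total boundary
    vanishes, [a] also occurs in [∂^- d] for a summand [d], and then
    [c <_q a <_q d] contradicts the choice of [c]. *)
Lemma positive_cycle_eq0 q (y : K q.+1) : dst y -> bd y = 0 -> y = 0.
Proof.
rewrite (hB q.+1).2 => -[s hs ->].
have [->|/eqP s0 E] := eqVneq s [::]; first by rewrite big_nil.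
have [lt [irr tr ltm ltp]] := hL q.
have ge r (b : K r) : B b -> (q <= r)%N -> basis_ge B q (hch b) by [].
have [c cs cmax] : exists2 c, c \in s & forall b, b \in s -> ~ lt (hch c) (hch b).
  apply: (maximal_in (lt := fun a b => lt (hch a) (hch b))
    (P := fun b : K q.+1 => B b)) => //.
  - by move=> a Ba; apply: irr; apply: ge.
  - by move=> a b d Ba Bb Bd; apply: tr; apply: ge.
have parts_seq (b : K q.+1) : exists st : seq (K q) * seq (K q),
    [/\ all_in (@B q) st.1, all_in (@B q) st.2 &
     parts (@B q) (bd b) = (\sum_(a <- st.1) a, \sum_(a <- st.2) a)].
  by have [t [u [ht hu _ ? _]]] := partsP (bd b) (hB q).1; exists (t, u).
pose P b := (sval (cid (parts_seq b))).1; pose M b := (sval (cid (parts_seq b))).2.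
have hP b : all_in (@B q) (P b) by rewrite /P; case: cid => /= ? [].
have hM b : all_in (@B q) (M b) by rewrite /M; case: cid => /= ? [].
have PM b : parts (@B q) (bd b) = (\sum_(a <- P b) a, \sum_(a <- M b) a).
  by rewrite /P /M; case: cid => /= ? [].
(* The sum of the [∂^+ b] equals that of the [∂^- b], so by freeness both have
   the same terms. *)
have perm : perm_eq (flatten [seq P b | b <- s]) (flatten [seq M b | b <- s]).
  apply: (zbasis_perm (hB q).1).
  - by move=> a /flatten_mapP[b _ /hP].
  - by move=> a /flatten_mapP[b _ /hM].
  rewrite !big_flatten !big_map; apply: subr0_eq.
  rewrite -sumrB -[RHS]E raddf_sum; apply: eq_bigr => b _.
  by have [_ [_ [_ _ _ _ ->]]] := partsP (bd b) (hB q).1; rewrite PM.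
have [a aP] : exists a, a \in P c.
  have := bdpart_neq0 (hs c cs); rewrite PM /=.
  by case: (P c) => [|a u _]; [rewrite big_nil | exists a; rewrite inE eqxx].
have : a \in flatten [seq P b | b <- s] by apply/flatten_mapP; exists c.
rewrite (perm_mem perm) => /flatten_mapP[d ds aM]; case: (cmax d ds).
have Ba : B a := hP c a aP.
apply: (tr _ (hch a)); try by apply: ge => //; apply: hs.
  apply: ltp; rewrite ?subSnn /=; try by [|apply: ge => //; apply: hs].
  by exists q, a, (\sum_(a <- P c) a); split=> //; [rewrite PM | exists (P c)].
apply: ltm; rewrite ?subSnn /=; try by [|apply: ge => //; apply: hs].
by exists q, a, (\sum_(a <- M d) a); split=> //; [rewrite PM | exists (M d)].
Qed.

End LoopFreeUnital.

(** On distinguished chains, induction on the degree: in degree 0 the image is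
    distinguished of augmentation 0, and from then on a distinguished cycle.
    These chains generate the chain groups.  Such maps [G] arise as the
    components of a morphism between objects [V(m, K)] at the pairs of indices
    where a morphism of the wreath product has none. *)
Lemma chain_map_aug0 (K L : adc) (G : forall q, {additive K q -> L q}) :
  in_Phi K -> in_Phi L ->
  (forall q (x : K q.+1), bd (G q.+1 x) = G q (bd x)) ->
  (forall q (x : K q), dst x -> dst (G q x)) ->
  (forall x, aug (G 0%N x) = 0) -> forall q x, G q x = 0.
Proof.
move=> [_ [B [hB _ _]]] [_ [C [hC hU hL]]] Gbd Gdst Gaug.
have ext q : (forall x : K q, dst x -> G q x = 0) -> forall x, G q x = 0.
  move=> H x; have [/(_ x)/zspanP[y [z [hy hz ->]]] _] := (hB q).1.
  by rewrite raddfB !H ?subr0 // (hB q).2.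
elim=> [|q IH]; apply: ext => x hx.
  by apply: (aug_dst_eq0 hC hU); [apply: Gdst | apply: Gaug].
by apply: (positive_cycle_eq0 hC hU hL); [apply: Gdst | rewrite Gbd IH].
Qed.

(** * Components of the complexes [V(m, K)] *)

Lemma dcomp_VbdS (X : wreath adc) q j (u : Vch X q.+2) :
  @dcomp _ (fun j => X j q) j (VbdS u) = bd (@dcomp _ (fun j => X j q.+1) j u).
Proof.
rewrite /VbdS raddf_sum (bigD1 j) //= [dcomp j (Vs _)]dcomp_in.
by rewrite big1 ?addr0 // => i ij; rewrite [LHS]dcomp_out.
Qed.

Lemma dcomp_Vdst (X : wreath adc) q j (u : Vch X q.+1) :
  Vdst u -> dst (@dcomp _ (fun j => X j q) j u).
Proof.
case=> s hs ->; rewrite raddf_sum big_seq.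
elim/big_ind: _ => [|*|v /hs[i [x [hx ->]]]]; [exact: dst0|exact: dstD|].
have [<-|ij] /= := eqVneq i j; first by rewrite [dcomp _ _]dcomp_in.
by rewrite [dcomp _ _]dcomp_out //; apply: dst0.
Qed.

Section Cut.
Variable X : wreath adc.
Variable j : 'I_(wr_len X).

(** The sum of the coefficients of the points to the right of the [j]-th gap:
    among the differences [p^(hi i) - p^(lo i)], which carry the boundaries of
    the chains of degree 1, it detects only [i = j]. *)
Definition cut (u : Vch X 0) : int :=
  \sum_(k < (wr_len X).+1 | (j < k)%N) @dcomp _ (fun=> int) k u.

Lemma cut_additive : zmod_morphism cut.
Proof. by move=> u v; rewrite /cut -sumrB; apply: eq_bigr => k _; rewrite raddfB. Qed.
HB.instance Definition _ :=
  GRing.isZmodMorphism.Build (Vch X 0) int cut cut_additive.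

Lemma cut_Vp k : cut (Vp k) = (j < k)%N%:R.
Proof.
rewrite /cut big_mkcond (bigD1 k) //= [dcomp _ _]dcomp_in big1 ?addr0.
  by case: ifP.
by move=> l lk; rewrite [dcomp _ _]dcomp_out 1?eq_sym //; case: ifP.
Qed.

Lemma cut_Vbd0 (w : Vch X 1) : cut (Vbd0 w) = aug (@dcomp _ (fun j => X j 0%N) j w).
Proof.
apply: (VchS_ext (f := cut \o @Vbd0 X)
  (g := aug \o (@dcomp _ (fun j => X j 0%N) j))) => i x /=.
rewrite Vbd0_s raddfMz raddfB /= !cut_Vp /= ltnS.
have [<-|ij] := eqVneq i j.
  by rewrite [dcomp _ _]dcomp_in leqnn ltnn subr0 intz.
rewrite [dcomp _ _]dcomp_out // raddf0 leq_eqVlt eq_sym.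
by rewrite (negPf ij : (i == j :> nat) = false) subrr mul0rz.
Qed.

End Cut.

(** * Components of a morphism [V(m, K) -> V(n, L)] *)

Section Components.
Variables (X Y : wreath adc) (F : adc_hom (V_ob X) (V_ob Y)).

Definition Vcomp i j q (x : X i q) : Y j q :=
  @dcomp _ (fun j => Y j q) j (F q.+1 (Vs x)).

Lemma Vcomp_additive i j q : zmod_morphism (@Vcomp i j q).
Proof. by move=> x y; rewrite /Vcomp !raddfB. Qed.
HB.instance Definition _ i j q := GRing.isZmodMorphism.Build
  (X i q) (Y j q) (@Vcomp i j q) (@Vcomp_additive i j q).

Lemma Vcomp_bd i j q (x : X i q.+1) : bd (Vcomp j x) = Vcomp j (bd x).
Proof.
by rewrite /Vcomp -VbdS_s -dcomp_VbdS; congr dcomp; apply: (hmap_bd F (Vs x)).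
Qed.

Lemma Vcomp_dst i j q (x : X i q) : dst x -> dst (Vcomp j x).
Proof.
move=> hx; apply: dcomp_Vdst.
have hs : @dst (V_ob X) q.+1 (Vs x) by apply: gen_submonoid_incl; exists i, x.
exact: (hmap_dst F hs).
Qed.

(** The image is a sum of points whose number is the augmentation of [p^i]. *)
Lemma hmap_Vp i : exists k, F 0%N (Vp i) = Vp k.
Proof.
have hp : @dst (V_ob X) 0 (Vp i) by apply: gen_submonoid_incl; exists i.
have [s hs E] : Vdst (F 0%N (Vp i)) := hmap_dst F hp.
have : Vaug (F 0%N (Vp i)) = 1.
  by rewrite -(Vaug_p i); apply: (hmap_aug F (Vp i)).
rewrite E raddf_sum big_seq (eq_bigr (fun=> 1)) => [|v /hs[k ->]]; last first.
  exact: Vaug_p.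
rewrite -big_seq big_const_seq count_predT iter_addr_0 natz => -[].
case: s hs {E} => [|v [|]] // hs _; rewrite big_seq1.
by have [|k ->] := hs v; [rewrite inE | exists k].
Qed.

Variable phi : 'I_(wr_len X).+1 -> 'I_(wr_len Y).+1.
Hypothesis hphi : forall i, F 0%N (Vp i) = Vp (phi i).

(** The cut at the [j]-th gap of the boundary of [F (s x)], computed as the image
    of the boundary of [s x]. *)
Lemma Vcomp_aug i j (x : X i 0%N) : aug (Vcomp j x) =
  ((j < phi (hi i))%N%:R - (j < phi (lo i))%N%:R) *~ aug x.
Proof.
rewrite /Vcomp -cut_Vbd0.
rewrite (_ : Vbd0 _ = F 0%N (Vbd0 (Vs x))); last exact: (hmap_bd F (Vs x)).
by rewrite Vbd0_s raddfMz raddfB /= !hphi raddfMz raddfB /= !cut_Vp.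
Qed.

Hypothesis hX : forall i, in_Phi (X i).
Hypothesis hY : forall j, in_Phi (Y j).

(** If [phi] stepped down on the [i]-th interval, the component of [F] at
    [j = phi (hi i)] would send a basis element of degree 0 to a distinguished
    chain of augmentation -1. *)
Lemma phi_step i : (phi (lo i) <= phi (hi i))%N.
Proof.
have [nz [B [hB hU _]]] := hX i; have [b Bb] := exists_basis0 hB hU nz.
have db : dst b by rewrite (hB 0).2; apply: gen_submonoid_incl.
rewrite leqNgt; apply/negP => lt_phi.
have kY : (phi (hi i) < wr_len Y)%N.
  by apply: leq_trans lt_phi _; rewrite -ltnS.
have [_ [C [hC hV _]]] := hY (Ordinal kY).
have := aug_dst_ge0 hC hV (Vcomp_dst (Ordinal kY) db).
by rewrite Vcomp_aug (aug_basis hU Bb) /= ltnn lt_phi.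
Qed.

Lemma phi_mono (i j : 'I_(wr_len X).+1) : (i <= j)%N -> (phi i <= phi j)%N.
Proof.
case: j => j jm; elim: j jm => [|j IH] jm ij.
  by rewrite (_ : i = Ordinal jm) //; apply: val_inj; apply/eqP; rewrite -leqn0.
move: ij; rewrite leq_eqVlt => /predU1P[ij|ij].
  by rewrite (_ : i = Ordinal jm) //; apply: val_inj.
have jm' : (j < wr_len X)%N by [].
apply: leq_trans (IH (ltnW jm) ij) _.
have := phi_step (Ordinal jm'); congr (_ <= _)%N; congr (nat_of_ord (phi _));
  exact: val_inj.
Qed.

Lemma Vcomp_block_aug i j (x : X i 0%N) : in_block phi i j ->
  aug (Vcomp j x) = aug x.
Proof.
by move=> /andP[h1 h2]; rewrite Vcomp_aug h2 ltnNge h1 subr0 intz.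
Qed.

Lemma Vcomp_out i j q (x : X i q) : ~~ in_block phi i j -> Vcomp j x = 0.
Proof.
move=> h; apply: (chain_map_aug0 (G := fun q => @Vcomp i j q)) => //.
- exact: Vcomp_bd.
- exact: Vcomp_dst.
move=> y; rewrite Vcomp_aug; move: h; rewrite negb_and -ltnNge.
have := phi_step i; case: (ltnP j (phi (lo i))) => h1 h2 h3.
  by rewrite (leq_trans h1 h2) subrr mul0rz.
by rewrite (negPf h3) subrr mul0rz.
Qed.

End Components.

(** * Full faithfulness *)

Lemma V_hom_ext (X Y : wreath adc) (F G : adc_hom (V_ob X) (V_ob Y)) :
  (forall i, F 0%N (Vp i) = G 0%N (Vp i)) ->
  (forall i j q (x : X i q), Vcomp F j x = Vcomp G j x) -> F = G.
Proof.
move=> E0 E; apply: adc_hom_eq => -[|q]; first exact: Vch0_ext.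
by apply: VchS_ext => i x; apply: dsumP => j; apply: E.
Qed.

Lemma Vcomp_V_hom (X Y : wreath adc) (f : Hom X Y) i j q (x : X i q) :
  Vcomp (V_hom f) j x = Vfam f j x.
Proof.
rewrite /Vcomp /= VhomS_s raddf_sum (bigD1 j) //= [dcomp _ (Vs _)]dcomp_in.
by rewrite big1 ?addr0 // => k kj; rewrite [LHS]dcomp_out.
Qed.

Lemma V_Phi_faithful (X Y : wreath Phi) : injective (@fhom _ _ V_Phi X Y).
Proof.
move=> f g E; pose J := wreath_functor (full_incl in_Phi).
have {}E : V_hom (fhom J f) = V_hom (fhom J g) by [].
apply: wr_hom_eq => [i|i j hf hg].
  apply: (@Vp_inj (J Y)).
  rewrite -[LHS](Vhom0_p (fhom J f) i) -[RHS](Vhom0_p (fhom J g) i).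
  exact: (congr1 (fun F : adc_hom (V_ob (J X)) (V_ob (J Y)) =>
    F 0%N (@Vp (J X) i)) E).
apply: adc_hom_eq => q x.
rewrite -[LHS](VfamE (f := fhom J f) x hf) -[RHS](VfamE (f := fhom J g) x hg).
by rewrite -!Vcomp_V_hom E.
Qed.

Lemma V_Phi_full (X Y : wreath Phi) (F : Hom (V_Phi X) (V_Phi Y)) :
  exists f : Hom X Y, fhom V_Phi f = F.
Proof.
pose J := wreath_functor (full_incl in_Phi).
have hX i : in_Phi (J X i) := svalP (X i).
have hY j : in_Phi (J Y j) := svalP (Y j).
have [phi hphi] : {phi | forall i, F 0%N (Vp i) = Vp (phi i)}.
  pose H i := cid (hmap_Vp (X := J X) (Y := J Y) F i).
  by exists (fun i => sval (H i)) => i; exact: (svalP (H i)).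
have mono := phi_mono hphi hX hY.
pose fam i j (h : in_block phi i j) : Hom (X i) (Y j) :=
  @AdcHom (J X i) (J Y j) (fun q => @Vcomp (J X) (J Y) F i j q)
    (@Vcomp_bd (J X) (J Y) F i j)
    (fun x => Vcomp_block_aug hphi x h) (@Vcomp_dst (J X) (J Y) F i j).
pose f : Hom X Y := @WrHom Phi X Y phi mono fam.
exists f; apply: (@V_hom_ext (J X) (J Y)) => [i|i j q x].
  by rewrite hphi; apply: (Vhom0_p (fhom J f)).
rewrite (Vcomp_V_hom (fhom J f)).
have [h|h] := boolP (in_block phi i j); first exact: (VfamE (f := fhom J f) x h).
by rewrite (Vfam0 (f := fhom J f) x h) (Vcomp_out hphi).
Qed.

Theorem theorem5p6 : fully_faithful V_Phi.
Proof.
move=> X Y; pose g F := sval (cid (@V_Phi_full X Y F)).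
have gK F : fhom V_Phi (g F) = F by rewrite /g; case: cid.
by exists g => // f; apply: V_Phi_faithful; rewrite gK.
Qed.
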